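(* Let $a,b,c$ be complex numbers and define, for integers $n\ge0$, $$\Omega_n(a,b,c):=\sum_{k=0}^{n-1}q^k\frac{(b/q;q)_k(cq;q)_{2k}}{(aq^3,c/(aq);q)_k(bcq^2;q^3)_k}.$$ Then for every integer $n\ge0$ (whenever no denominator vanishes) $$\Omega_n(a,b,c)=\frac{c(q-b)(aq;q)_2}{(b-aq^3)(1-c)(aq-c)}\Omega_n(a/q^2,bq,c/q)+\frac{q(1-aq^2)(1-bc/q)}{(b-aq^3)(1-c)}\left\{1-\frac{(b/q;q)_n(c;q)_{2n}}{(aq^2,c/(aq);q)_n(bc/q;q^3)_n}\right\}.$$
   Context: $q$ is a complex number with $|q|<1$. For a base $p$ and integer $k\ge0$, $(z;p)_k:=\prod_{j=0}^{k-1}(1-zp^j)$, and $(z_1,\dots,z_m;p)_k:=(z_1;p)_k\cdots(z_m;p)_k$. *)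

(* Defs.v *)
From mathcomp Require Export all_boot all_order all_algebra.
From mathcomp Require Export reals complex.

Set Implicit Arguments.
Unset Strict Implicit.
Unset Printing Implicit Defensive.

Import GRing.Theory.
Local Open Scope ring_scope.

Definition qpoch (F : fieldType) (z p : F) (k : nat) : F :=
  \prod_(0 <= j < k) (1 - z * p ^+ j).

(* [qpochs [:: z_1; ...; z_m] p k] is (z_1, ..., z_m; p)_k. *)
Definition qpochs (F : fieldType) (zs : seq F) (p : F) (k : nat) : F :=
  \prod_(z <- zs) qpoch z p k.

(* The denominator of the k-th summand of Omega_n(a, b, c). *)
Definition Omega_den (F : fieldType) (q a b c : F) (k : nat) : F :=
  qpochs [:: a * q ^+ 3; c / (a * q)] q k * qpoch (b * c * q ^+ 2) (q ^+ 3) k.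

Definition Omega (F : fieldType) (q : F) (n : nat) (a b c : F) : F :=
  \sum_(0 <= k < n)
    q ^+ k * ((qpoch (b / q) q k * qpoch (c * q) q (2 * k))
              / Omega_den q a b c k).

(* Main.v *)
(** The identity telescopes: writing [G k] for the quotient in the last bracket,
    the [k]-th summands [T] and [T'] of the two sums satisfy
    [T k = A * T' k + B * (G k - G k.+1)].  Since
    [(1 - z) (z p; p)_k = (z; p)_k (1 - z p^k)], both [T k] and [A * T' k] are
    rational multiples of [G k], so that this reduces to a rational identity in
    [q], [a], [b], [c] and [q ^+ k]. *)

Require Import Defs.
From mathcomp Require Import ring.

Import GRing.Theory Num.Theory.
Local Open Scope ring_scope.
Local Open Scope complex_scope.

Set Implicit Arguments.
Unset Strict Implicit.

Section QPochhammer.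
Variable F : fieldType.
Implicit Types z p q a b c : F.

Lemma qpoch0 z p : qpoch z p 0 = 1.
Proof. by rewrite /qpoch big_geq. Qed.

Lemma qpochS z p k : qpoch z p k.+1 = qpoch z p k * (1 - z * p ^+ k).
Proof. by rewrite /qpoch big_nat_recr. Qed.

(** Both sides are [qpoch z p k.+1], with its first or its last factor split off. *)
Lemma qpoch_shift z p k :
  (1 - z) * qpoch (z * p) p k = qpoch z p k * (1 - z * p ^+ k).
Proof.
elim: k => [|k IHk]; first by rewrite !qpoch0 expr0; ring.
by rewrite qpochS mulrA IHk -qpochS exprS mulrA.
Qed.

Lemma qpoch_neq0 z p k n : (k <= n)%N -> qpoch z p n != 0 -> qpoch z p k != 0.
Proof.
move=> le_kn; rewrite -(subnKC le_kn); elim: (n - k)%N => [|m IHm].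
  by rewrite addn0.
by rewrite addnS qpochS mulf_eq0 negb_or => /andP[/IHm].
Qed.

Lemma qpoch_factor_neq0 z p k n :
  (k < n)%N -> qpoch z p n != 0 -> 1 - z * p ^+ k != 0.
Proof.
by move=> lt_kn /(qpoch_neq0 lt_kn); rewrite qpochS mulf_eq0 negb_or => /andP[].
Qed.

Lemma qpochs2 z1 z2 p k : qpochs [:: z1; z2] p k = qpoch z1 p k * qpoch z2 p k.
Proof. by rewrite /qpochs !big_cons big_nil mulr1. Qed.

(** The parameter shift preserves [b * c], so the symbol in base [q ^+ 3] is common to both sums. *)
Lemma Omega_shift_den q a b c k : q != 0 -> a != 0 ->
  Omega_den q (a / q ^+ 2) (b * q) (c / q) k =
  qpoch (a * q) q k * qpoch (c / a) q k * qpoch (b * c * q ^+ 2) (q ^+ 3) k.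
Proof.
move=> q0 a0; rewrite /Omega_den qpochs2.
by congr (qpoch _ q k * qpoch _ q k * qpoch _ _ k); field; rewrite ?a0 ?q0.
Qed.

(** This is the [G k] of the telescoping argument. *)
Definition Omega_rest q a b c k : F :=
  qpoch (b / q) q k * qpoch c q (2 * k)
    / (qpochs [:: a * q ^+ 2; c / (a * q)] q k * qpoch (b * c / q) (q ^+ 3) k).

(** Nonvanishing is assumed at [k.+1] so that it covers the factors of index [k], and those of index
    0 even when [k = 0]. *)
Lemma Omega_summand_rest q a b c k : q != 0 -> a != 0 -> 1 - c != 0 ->
  qpochs [:: a * q ^+ 2; c / (a * q)] q k.+1
    * qpoch (b * c / q) (q ^+ 3) k.+1 != 0 ->
  q ^+ k * ((qpoch (b / q) q k * qpoch (c * q) q (2 * k))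
              / Omega_den q a b c k)
  = Omega_rest q a b c k * q ^+ k * (1 - c * q ^+ (2 * k))
    * (1 - a * q ^+ 2) * (1 - b * c / q)
    / ((1 - c) * (1 - a * q ^+ 2 * q ^+ k)
       * (1 - b * c / q * (q ^+ 3) ^+ k)).
Proof.
move=> q0 a0 c0; rewrite qpochs2 !mulf_eq0 !negb_or => /andP[/andP[D0 E0] M0].
have [Dk Mk] := (qpoch_neq0 (leqnSn k) D0, qpoch_neq0 (leqnSn k) M0).
have [dk mk] := (qpoch_factor_neq0 (ltnSn k) D0, qpoch_factor_neq0 (ltnSn k) M0).
have Ek := qpoch_neq0 (leqnSn k) E0.
have d0 := qpoch_factor_neq0 (ltn0Sn k) D0.
have m0 := qpoch_factor_neq0 (ltn0Sn k) M0.
rewrite expr0 mulr1 in d0; rewrite expr0 mulr1 in m0.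
have sC := qpoch_shift c q (2 * k).
have sD := qpoch_shift (a * q ^+ 2) q k.
have sM := qpoch_shift (b * c / q) (q ^+ 3) k.
have aE : a * q ^+ 2 * q = a * q ^+ 3 by ring.
have mE : b * c / q * q ^+ 3 = b * c * q ^+ 2 by field.
rewrite aE in sD; rewrite mE in sM.
rewrite /Omega_den /Omega_rest !qpochs2.
(* Each shift relation is solved for its shifted symbol, leaving only the symbols that occur in
   [Omega_rest]. *)
have -> : qpoch (c * q) q (2 * k) =
          qpoch c q (2 * k) * (1 - c * q ^+ (2 * k)) / (1 - c).
  by rewrite -sC [RHS]mulrC mulKf.
have -> : qpoch (a * q ^+ 3) q k = qpoch (a * q ^+ 2) q k
            * (1 - a * q ^+ 2 * q ^+ k) / (1 - a * q ^+ 2).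
  by rewrite -sD [RHS]mulrC mulKf.
have -> : qpoch (b * c * q ^+ 2) (q ^+ 3) k = qpoch (b * c / q) (q ^+ 3) k
            * (1 - b * c / q * (q ^+ 3) ^+ k) / (1 - b * c / q).
  by rewrite -sM [RHS]mulrC mulKf.
(* Symbols and linear factors become independent atoms, so that [field] meets a small identity and
   its side conditions are the hypotheses at hand. *)
move: (qpoch (b / q) q k) (qpoch c q (2 * k)) => B C.
move: (qpoch (a * q ^+ 2) q k) (qpoch (c / (a * q)) q k) Dk Ek => D E Dk Ek.
move: (qpoch (b * c / q) (q ^+ 3) k) Mk => M Mk.
move: (1 - a * q ^+ 2 * q ^+ k) dk (1 - b * c / q * (q ^+ 3) ^+ k) mk => d dk m mk.
move: (1 - a * q ^+ 2) d0 (1 - b * c / q) m0 (1 - c) c0 => d' d0 m' m0 c' c0.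
move: (q ^+ k) (1 - c * q ^+ (2 * k)) => x y.
by field; rewrite ?Dk ?Ek ?Mk ?dk ?mk ?d0 ?m0 ?c0.
Qed.

(* The factors [q - b] and [1 - a q], which may vanish, stay on the left. *)
Lemma Omega_shift_summand_rest q a b c k : q != 0 -> a != 0 ->
  Omega_den q (a / q ^+ 2) (b * q) (c / q) k != 0 ->
  qpochs [:: a * q ^+ 2; c / (a * q)] q k.+1
    * qpoch (b * c / q) (q ^+ 3) k.+1 != 0 ->
  (q - b) * (1 - a * q)
    * (q ^+ k * ((qpoch (b * q / q) q k * qpoch (c / q * q) q (2 * k))
                  / Omega_den q (a / q ^+ 2) (b * q) (c / q) k))
  = Omega_rest q a b c k * q ^+ k * q * (1 - b / q * q ^+ k)
    * (1 - a * q * q ^+ k) * (1 - c / (a * q)) * (1 - b * c / q)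
    / ((1 - c / (a * q) * q ^+ k) * (1 - b * c / q * (q ^+ 3) ^+ k)).
Proof.
move=> q0 a0; rewrite Omega_shift_den // qpochs2 !mulf_eq0 !negb_or.
move=> /andP[/andP[A1 E1] _] /andP[/andP[D0 E0] M0].
have [Ek Mk] := (qpoch_neq0 (leqnSn k) E0, qpoch_neq0 (leqnSn k) M0).
have [ek mk] := (qpoch_factor_neq0 (ltnSn k) E0, qpoch_factor_neq0 (ltnSn k) M0).
have Dk := qpoch_neq0 (leqnSn k) D0.
have e0 := qpoch_factor_neq0 (ltn0Sn k) E0.
have m0 := qpoch_factor_neq0 (ltn0Sn k) M0.
rewrite expr0 mulr1 in e0; rewrite expr0 mulr1 in m0.
have sB := qpoch_shift (b / q) q k.
have sA := qpoch_shift (a * q) q k.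
have sE := qpoch_shift (c / (a * q)) q k.
have sM := qpoch_shift (b * c / q) (q ^+ 3) k.
have bE : b / q * q = b by field.
have aE : a * q * q = a * q ^+ 2 by ring.
have eE : c / (a * q) * q = c / a by field; rewrite a0 q0.
have mE : b * c / q * q ^+ 3 = b * c * q ^+ 2 by field.
rewrite bE in sB; rewrite aE in sA; rewrite eE in sE; rewrite mE in sM.
rewrite /Omega_rest !qpochs2 mulfK // divfK //.
have -> : qpoch (c / a) q k = qpoch (c / (a * q)) q k
            * (1 - c / (a * q) * q ^+ k) / (1 - c / (a * q)).
  by rewrite -sE [RHS]mulrC mulKf.
have -> : qpoch (b * c * q ^+ 2) (q ^+ 3) k = qpoch (b * c / q) (q ^+ 3) k
            * (1 - b * c / q * (q ^+ 3) ^+ k) / (1 - b * c / q).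
  by rewrite -sM [RHS]mulrC mulKf.
(* As [1 - a * q] may be 0, the shift relation is not divided by it; the quotient form divides only
   by the two symbols, nonzero by [A1] and [Dk]. *)
have sA' : (1 - a * q) / qpoch (a * q) q k =
           (1 - a * q * q ^+ k) / qpoch (a * q ^+ 2) q k.
  by apply/eqP; rewrite eqr_div // sA mulrC.
have sB' : (q - b) * qpoch b q k =
           q * (qpoch (b / q) q k * (1 - b / q * q ^+ k)).
  by rewrite -sB mulrA; congr (_ * _); field.
(* Each factor that may vanish is brought next to the symbol that absorbs it. *)
have reg B C A E M x : (q - b) * (1 - a * q) * (x * (B * C / (A * E * M))) =
    ((q - b) * B) * ((1 - a * q) / A) * (x * C / (E * M)).
  by rewrite !invfM; ring.
rewrite reg sA' sB' {reg sA' sB' sA sB sE sM}.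
move: (qpoch (b / q) q k) (qpoch c q (2 * k)) => B C.
move: (qpoch (a * q ^+ 2) q k) (qpoch (c / (a * q)) q k) Dk Ek => D E Dk Ek.
move: (qpoch (b * c / q) (q ^+ 3) k) Mk => M Mk.
move: (1 - c / (a * q) * q ^+ k) ek (1 - b * c / q * (q ^+ 3) ^+ k) mk => e ek m mk.
move: (1 - c / (a * q)) e0 (1 - b * c / q) m0 => e' e0 m' m0.
move: (q ^+ k) => x.
by field; rewrite ?q0 ?Dk ?Ek ?Mk ?ek ?mk ?e0 ?m0.
Qed.

Lemma Omega_rest0 q a b c : Omega_rest q a b c 0 = 1.
Proof. by rewrite /Omega_rest qpochs2 muln0 !qpoch0 !mulr1 divr1. Qed.

Lemma Omega_restS q a b c k :
  Omega_rest q a b c k.+1 = Omega_rest q a b c k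
    * ((1 - b / q * q ^+ k) * (1 - c * q ^+ (2 * k)) * (1 - c * q ^+ (2 * k).+1)
       / ((1 - a * q ^+ 2 * q ^+ k) * (1 - c / (a * q) * q ^+ k)
          * (1 - b * c / q * (q ^+ 3) ^+ k))).
Proof. by rewrite /Omega_rest !qpochs2 mulnS !add2n !qpochS !invfM; ring. Qed.

Lemma Omega_telescope q a b c k : q != 0 -> a != 0 ->
  b - a * q ^+ 3 != 0 -> 1 - c != 0 -> a * q - c != 0 ->
  Omega_den q (a / q ^+ 2) (b * q) (c / q) k != 0 ->
  qpochs [:: a * q ^+ 2; c / (a * q)] q k.+1
    * qpoch (b * c / q) (q ^+ 3) k.+1 != 0 ->
  q ^+ k * ((qpoch (b / q) q k * qpoch (c * q) q (2 * k))
              / Omega_den q a b c k) =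
  c * (q - b) * qpoch (a * q) q 2
    / ((b - a * q ^+ 3) * (1 - c) * (a * q - c))
    * (q ^+ k * ((qpoch (b * q / q) q k * qpoch (c / q * q) q (2 * k))
                  / Omega_den q (a / q ^+ 2) (b * q) (c / q) k))
  + q * (1 - a * q ^+ 2) * (1 - b * c / q) / ((b - a * q ^+ 3) * (1 - c))
    * (Omega_rest q a b c k - Omega_rest q a b c k.+1).
Proof.
move=> q0 a0 hb hc hac h1 h2.
rewrite (Omega_summand_rest q0 a0 hc h2).
have -> : qpoch (a * q) q 2 = (1 - a * q) * (1 - a * q ^+ 2).
  by rewrite !qpochS qpoch0; ring.
(* The product [(q - b) * (1 - a * q)] is isolated to match the left side of
   [Omega_shift_summand_rest]. *)
have reg d x : c * (q - b) * ((1 - a * q) * (1 - a * q ^+ 2)) / d * x =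
   c * (1 - a * q ^+ 2) / d * ((q - b) * (1 - a * q) * x) by ring.
rewrite reg (Omega_shift_summand_rest q0 a0 h1 h2) Omega_restS {reg}.
move: h2; rewrite qpochs2 !mulf_eq0 !negb_or => /andP[/andP[D0 E0] M0].
have dk := qpoch_factor_neq0 (ltnSn k) D0.
have ek := qpoch_factor_neq0 (ltnSn k) E0.
have mk := qpoch_factor_neq0 (ltnSn k) M0.
(* All powers depending on [k] are rewritten through [q ^+ k], the variable [x] of the final
   rational identity. *)
move: dk ek mk; rewrite (exprS _ (2 * k)) mulnC exprM -exprM [(3 * k)%N]mulnC exprM => {D0 E0 M0}.
move: (Omega_rest q a b c k) (q ^+ k) => G x {h1} dk ek mk.
(* [field] clears inner fractions, so the nonvanishing facts are restated with denominators
   removed. *)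
have ek' : a * q - c * x != 0.
  apply: contra_neq ek => h.
  have -> : 1 - c / (a * q) * x = (a * q - c * x) / (a * q).
    by field; rewrite a0 q0.
  by rewrite h mul0r.
have mk' : q - b * c * x ^+ 3 != 0.
  apply: contra_neq mk => h.
  have -> : 1 - b * c / q * x ^+ 3 = (q - b * c * x ^+ 3) / q by field.
  by rewrite h mul0r.
by field; rewrite ?q0 ?a0 ?hb ?hc ?hac ?dk ?ek' ?mk'.
Qed.

End QPochhammer.

Theorem theorem3p2 (R : realType) (q a b c : R[i]) (n : nat)
  (hq : `|q| < 1)
  (hq0 : q != 0)
  (ha0 : a != 0)
  (hOmega : forall k, (k < n)%N -> Omega_den q a b c k != 0)
  (hOmega' : forall k, (k < n)%N ->
     Omega_den q (a / q ^+ 2) (b * q) (c / q) k != 0)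
  (hb : b - a * q ^+ 3 != 0)
  (hc : 1 - c != 0)
  (hac : a * q - c != 0)
  (hden : qpochs [:: a * q ^+ 2; c / (a * q)] q n
          * qpoch (b * c / q) (q ^+ 3) n != 0) :
  Omega q n a b c =
    c * (q - b) * qpoch (a * q) q 2
      / ((b - a * q ^+ 3) * (1 - c) * (a * q - c))
      * Omega q n (a / q ^+ 2) (b * q) (c / q)
    + q * (1 - a * q ^+ 2) * (1 - b * c / q)
      / ((b - a * q ^+ 3) * (1 - c))
      * (1 - (qpoch (b / q) q n * qpoch c q (2 * n))
             / (qpochs [:: a * q ^+ 2; c / (a * q)] q n
                * qpoch (b * c / q) (q ^+ 3) n)).
Proof.
rewrite /Omega -/(Omega_rest q a b c n).
(* The 1 is [Omega_rest] at index 0, so the bracket is a telescoping sum. *)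
have -> : 1 - Omega_rest q a b c n =
    \sum_(0 <= k < n) (Omega_rest q a b c k - Omega_rest q a b c k.+1).
  rewrite -[RHS]opprK -sumrN -(Omega_rest0 q a b c).
  by under eq_bigr do rewrite opprB; rewrite telescope_sumr // opprB.
rewrite !mulr_sumr -big_split /=; apply: eq_big_nat => k /andP[_ lt_kn].
apply: Omega_telescope => //; first exact: hOmega'.
(* Since [k < n] means [k.+1 <= n], nonvanishing at [n] passes to [k.+1]. *)
move: hden; rewrite !qpochs2 !mulf_eq0 !negb_or => /andP[/andP[hD hE] hM].
by rewrite (qpoch_neq0 lt_kn hD) (qpoch_neq0 lt_kn hE) (qpoch_neq0 lt_kn hM).
Qed.
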